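(* For $i=1,2$ let $L^i,R^i:[0,\infty)\times\mathbb{R}\to\mathbb{R}$ satisfy: (i) for each $x\in\mathbb{R}$, $L^i(\cdot,x),R^i(\cdot,x)\in D[0,\infty)$; (ii) for each $t\ge 0$, $L^i(t,\cdot)$ and $R^i(t,\cdot)$ are strictly increasing; (iii) there are constants $0<c<C<\infty$ such that $c|x-y|\le |L^i(t,x)-L^i(t,y)|\le C|x-y|$ and $c|x-y|\le |R^i(t,x)-R^i(t,y)|\le C|x-y|$ for all $t\ge 0$, $x,y\in\mathbb{R}$; (iv) $\inf_{(t,x)\in[0,\infty)\times\mathbb{R}}(R^i(t,x)-L^i(t,x))>0$. Suppose $R^1\ge R^2$ and $L^1\le L^2$ pointwise. Let $S\in D[0,\infty)$ and, for $i=1,2$, let $(X^i,K^i)$ be the solution of the Skorokhod problem $\mathbb{SP}_{L^i}^{R^i}(S)$ with decomposition $K^i=K^{i,r}-K^{i,l}$ as in the definition of a solution. Then for every $t\ge 0$, $$K^{2,r}_t\ge K^{1,r}_t\quad\text{and}\quad K^{2,l}_t\ge K^{1,l}_t.$$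
   Context: $D[0,\infty)$ is the set of real-valued right-continuous functions on $[0,\infty)$ with left limits; $BV[0,\infty)$ is the set of $K\in D[0,\infty)$ of bounded variation on each compact interval. Skorokhod problem $\mathbb{SP}_L^R(S)$: a pair $(X,K)\in D[0,\infty)\times BV[0,\infty)$ is a solution if (a) $X_t=S_t+K_t$ for all $t\ge0$; (b) $L(t,X_t)\le 0\le R(t,X_t)$ for all $t\ge 0$; (c) $K_{0-}=0$ and $K=K^r-K^l$, where $K^r,K^l$ are nondecreasing (right-continuous, with $K^r_{0-}=K^l_{0-}=0$) and $\int_0^\infty I_{\{L(s,X_s)<0\}}dK^l_s=0$, $\int_0^\infty I_{\{R(s,X_s)>0\}}dK^r_s=0$. The integrals are over $[0,\infty)$ including time $0$, where $dK^r,dK^l$ have atoms of mass $K^r_0,K^l_0$. Under hypotheses (i)–(iv), this problem has a unique solution for every $S\in D[0,\infty)$. *)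

(* Defs.v *)
From HB Require Import structures.
From mathcomp Require Import all_boot all_order all_algebra.
From mathcomp Require Import all_classical all_reals all_analysis.

Set Implicit Arguments.
Unset Strict Implicit.
Unset Printing Implicit Defensive.

Import Order.TTheory GRing.Theory Num.Theory.
Import numFieldNormedType.Exports.

Local Open Scope classical_set_scope.
Local Open Scope ring_scope.

(* A function on [0, oo) is represented by a function on R; its values at
   negative times are irrelevant unless stated otherwise. *)

Definition cadlag (R : realType) (f : R -> R) : Prop :=
  (forall t : R, 0 <= t -> f x @[x --> t^'+] --> f t) /\
  (forall t : R, 0 < t -> cvg (f x @[x --> t^'-])).

Definition cadlag_BV (R : realType) (f : R -> R) : Prop :=
  cadlag f /\ forall a b : R, 0 <= a -> a <= b -> bounded_variation a b f.

Definition barrier (R : realType) (h : R -> R -> R) : Prop :=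
  (forall x, cadlag (fun t => h t x)) /\
  (forall t : R, 0 <= t -> {homo h t : x y / x < y}).

Definition bi_lipschitz (R : realType) (c C : R) (h : R -> R -> R) : Prop :=
  forall t x y : R, 0 <= t ->
    c * `|x - y| <= `|h t x - h t y| /\ `|h t x - h t y| <= C * `|x - y|.

Definition barrier_pair (R : realType) (l r : R -> R -> R) : Prop :=
  [/\ barrier l, barrier r,
      exists c C : R,
        [/\ 0 < c, c < C, bi_lipschitz c C l & bi_lipschitz c C r] &
      (0 < ereal_inf [set (r p.1 p.2 - l p.1 p.2)%:E
                     | p in `[0%R, +oo[ `*` [set: R]])%E].

(* The convention "value 0 at time 0-" is encoded by extending a function by 0
   to the negative half-line, so that the Lebesgue-Stieltjes measure of the
   extended function has an atom at 0 whose mass is the value at 0. *)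
Definition zero_before (R : realType) (f : R -> R) : Prop :=
  forall t : R, t < 0 -> f t = 0.

Definition skorokhod_decomposition (R : realType) (l r : R -> R -> R)
    (X K : R -> R) (Kr Kl : cumulative R R) : Prop :=
  [/\ zero_before K, zero_before Kr /\ zero_before Kl,
      forall t : R, 0 <= t -> K t = Kr t - Kl t,
      (\int[lebesgue_stieltjes_measure Kl]_(s in `[0%R, +oo[)
         (\1_[set u | (l u (X u) < 0)%R] s)%:E = 0)%E &
      (\int[lebesgue_stieltjes_measure Kr]_(s in `[0%R, +oo[)
         (\1_[set u | (0 < r u (X u))%R] s)%:E = 0)%E].

Definition skorokhod_solution (R : realType) (l r : R -> R -> R)
    (S X K : R -> R) : Prop :=
  [/\ cadlag X, cadlag_BV K,
      forall t : R, 0 <= t -> X t = S t + K t,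
      forall t : R, 0 <= t -> l t (X t) <= 0 /\ 0 <= r t (X t) &
      exists Kr Kl : cumulative R R, skorokhod_decomposition l r X K Kr Kl].

(* Main.v *)
(* Suppose [Kr1 t > Kr2 t]. The mass that [Kr1] acquires on
   [{s <= t | Kr1 s > Kr2 t}] is carried by times [p] at which
   [R1 p (X1 p) <= 0 <= R2 p (X2 p) <= R1 p (X2 p)], so [X1 p <= X2 p], and
   [Kr1 p > Kr2 p] then forces [Kl1 p > Kl2 p]. Symmetrically, a violation for
   [Kl] yields an earlier one for both components at which [X1] is on the upper
   barrier. Alternating, [X1] visits both barriers arbitrarily close to the
   right of some time [T], hence [R1 T (X1 T) <= 0 <= L1 T (X1 T)] by right
   continuity, which the gap between the barriers excludes. *)
Require Import Defs.
From HB Require Import structures.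
From mathcomp Require Import all_boot all_order all_algebra.
From mathcomp Require Import all_classical all_reals all_analysis.
From mathcomp Require Import lra.
Import Order.TTheory GRing.Theory Num.Theory.
Import numFieldNormedType.Exports.
Local Open Scope classical_set_scope.
Local Open Scope ring_scope.

(* [E] need not be measurable: the integral of a nonnegative function is a
   supremum over the simple functions below it. *)
Lemma measure_le_integral_indic {d} {T : measurableType d} {R : realType}
    (mu : {measure set T -> \bar R}) (A D E : set T) :
  measurable A -> A `<=` D -> A `<=` E ->
  (mu A <= \int[mu]_(x in D) (\1_E x)%:E)%E.
Proof.
move=> mA AD AE.
rewrite ge0_integralE; last by move=> x _; rewrite lee_fin.
apply: ereal_sup_ubound; exists (indic_nnsfun R mA) => /=; last first.
  exact: sintegral_indic.
move=> x; change ((\1_A x : R)%:E <= ((fun x => (\1_E x : R)%:E) \_ D) x)%E; rewrite /patch.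
have [xA|xA] := boolP (x \in A); last first.
  by rewrite indicE (negbTE xA); case: ifP; rewrite ?lee_fin.
rewrite inE in xA.
by rewrite (mem_set (AD _ xA)) !indicE (mem_set xA) (mem_set (AE _ xA)).
Qed.

Lemma lebesgue_stieltjes_itvoc {R : realType} (F : cumulative R R) (a b : R) :
  a <= b -> lebesgue_stieltjes_measure F `]a, b]%classic = (F b - F a)%:E.
Proof.
move=> ab; rewrite /lebesgue_stieltjes_measure /measure_extension/=.
by rewrite measurable_mu_extE/= ?wlength_itv_bnd//; exact: is_ocitv.
Qed.

(** Continuity from below along the half-open intervals ending at [b - 1/(n+1)]. The bound [c]
    stands in for the left limit of [F] at [b]. *)
Lemma lebesgue_stieltjes_itvoo_le {R : realType} (F : cumulative R R)
    (a b c : R) :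
  F a <= c -> (forall x, a < x < b -> F x <= c) ->
  (lebesgue_stieltjes_measure F `]a, b[%classic <= (c - F a)%:E)%E.
Proof.
move=> ac Fc; rewrite itv_bnd_open_bigcup.
set I := fun n : nat => [set` Interval (BRight a) (BRight (b - n.+1%:R^-1))].
have : lebesgue_stieltjes_measure F (I n) @[n --> \oo] -->
    lebesgue_stieltjes_measure F (\bigcup_n I n).
  apply: nondecreasing_cvg_mu; rewrite /I//.
  - exact: bigcup_measurable.
  - move=> m n mn; apply/subsetPset/subset_itv; rewrite // leBSide/=.
    by rewrite lerD2l lerN2 lef_pV2 ?posrE// ler_nat.
move=> cI; rewrite -(cvg_lim _ cI)//; apply: lime_le.
  by apply/cvg_ex; eexists; exact: cI.
apply: nearW => n; have [ab|ba] := ltP a (b - n.+1%:R^-1).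
  rewrite lebesgue_stieltjes_itvoc ?(ltW ab)// lee_fin lerD2r Fc// ab/=.
  by rewrite ltrBlDr ltrDl invr_gt0.
(* For small [n] the interval is empty, and [F a <= c] suffices. *)
rewrite /I set_itv_ge; last by rewrite bnd_simp -leNgt.
by rewrite measure0 lee_fin subr_ge0.
Qed.

(** Otherwise the times up to [t] at which [F] exceeds [c] all lie in [E], hence form a null set;
    but [F] cannot climb above [c] without charging it. *)
Lemma increase_outside_null {R : realType} (F : cumulative R R) (E : set R)
    (t c : R) :
  zero_before F ->
  (\int[lebesgue_stieltjes_measure F]_(s in `[0%R, +oo[) (\1_E s)%:E = 0)%E ->
  0 <= c -> c < F t ->
  exists p : R, [/\ 0 <= p, p <= t, c < F p & ~ E p].
Proof.
move=> F0 E0 c0 cFt; have ndF := cumulative_is_nondecreasing F.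
apply: contrapT => noE.
have AE p : c < F p -> p <= t -> 0 <= p /\ E p.
  move=> cFp pt; have p0 : 0 <= p.
    by rewrite leNgt; apply/negP => /F0 Fp0; move: cFp; rewrite Fp0 ltNge c0.
  by split=> //; apply: contrapT => Ep; apply: noE; exists p.
pose A : set R := [set p | c < F p] `&` `]-oo, t].
have t0 : 0 <= t by have [] := AE t cFt (lexx t).
have A0 : A !=set0 by exists t; split=> //=; rewrite in_itv/=.
have lbA : lbound A 0.
  by move=> p [/= cFp]; rewrite in_itv/= => pt; have [] := AE p cFp pt.
pose s := inf A.
have s0 : 0 <= s by exact: lb_le_inf.
have st : s <= t.
  by apply: ge_inf; [exists 0 | split=> //=; rewrite in_itv/=].
have below x : x < s -> F x <= c.
  move=> xs; rewrite leNgt; apply/negP => cFx.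
  suff : s <= x by rewrite leNgt xs.
  by apply: ge_inf; [exists 0 | split=> //=; rewrite in_itv/= ltW// (lt_le_trans xs)].
have above x : s < x -> c < F x.
  move=> /(inf_lt A0) [y [/= cFy _] yx].
  by rewrite (lt_le_trans cFy)// ndF// ltW.
(* Starting from a negative time includes the atom at 0, so []-1, t]] has mass [F t]. *)
have Fm1 : F (-1) = 0 by apply: F0; rewrite ltrN10.
have mu_null (B : set R) : measurable B -> B `<=` A ->
    lebesgue_stieltjes_measure F B = 0%E.
  move=> mB BA; apply/eqP; rewrite eq_le measure_ge0 andbT -[X in (_ <= X)%E]E0.
  apply: measure_le_integral_indic => // x /BA [/= cFx]; rewrite in_itv/= => xt.
    by rewrite in_itv/= andbT; have [] := AE x cFx xt.
  by have [] := AE x cFx xt.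
(* If [F] jumps above [c] at [s], then [s] belongs to [A] and its atom is null too; otherwise only
   []s, t]] lies in [A], and [F t = F s]. *)
have [cFs|Fsc] := ltP c (F s).
- have : (lebesgue_stieltjes_measure F `](-1)%R, t]%classic <= c%:E)%E.
    have -> : `](-1)%R, t]%classic = `]-1, s[%classic `|` `[s, t]%classic.
      by rewrite (@itv_bndbnd_setU _ _ _ (BLeft s)) ?bnd_simp//; lra.
    apply: le_trans (measureU2 _ _ _) _ => //; try exact: measurable_itv.
    rewrite [X in (_ + X)%E]mu_null ?adde0; last 2 first.
    + exact: measurable_itv.
    + move=> x /=; rewrite in_itv/= => /andP[sx xt]; split => /=.
        by rewrite (lt_le_trans cFs)// ndF.
      by rewrite in_itv.
    rewrite -[c]subr0 -Fm1; apply: lebesgue_stieltjes_itvoo_le; rewrite ?Fm1//.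
    by move=> x /andP[_ /below].
  rewrite lebesgue_stieltjes_itvoc; last lra.
  by rewrite lee_fin Fm1 subr0 leNgt cFt.
- have : lebesgue_stieltjes_measure F `]s, t]%classic = 0%E.
    apply: mu_null; first exact: measurable_itv.
    move=> x /=; rewrite in_itv/= => /andP[/above sx xt]; by split.
  rewrite lebesgue_stieltjes_itvoc// => -[] /eqP; rewrite subr_eq0 => /eqP Ft.
  by move: cFt; rewrite Ft ltNge Fsc.
Qed.

(** Freeze the space variable at [X t] and use right continuity in time; the Lipschitz bound,
    uniform in time, controls the change from [X t] to [X s]. *)
Lemma right_continuous_barrier_comp {R : realType} (h : R -> R -> R)
    (X : R -> R) (c C : R) :
  barrier h -> bi_lipschitz c C h -> cadlag X ->
  forall t : R, 0 <= t -> h s (X s) @[s --> t^'+] --> h t (X t).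
Proof.
move=> [hD _] hlip [rcX _] t t0.
have C0 : 0 <= C.
  have [_] := hlip 0 1 0 (lexx 0).
  by rewrite subr0 normr1 mulr1; apply: le_trans.
have rch : h s (X t) @[s --> t^'+] --> h t (X t) by exact: (hD (X t)).1.
apply/cvgrPdist_lt => e e0.
have e2 : 0 < e / 2 by rewrite divr_gt0.
(* Only [0 <= C] is known here, so the division is by [C + 1]. *)
have eC : 0 < e / 2 / (C + 1) by rewrite divr_gt0// ltr_wpDl.
move: (rcX t t0) => /cvgrPdist_lt /(_ _ eC) nX.
move: rch => /cvgrPdist_lt /(_ _ e2) nh.
near=> s.
have ts : t < s by near: s; exact: nbhs_right_gt.
have sX : `|X t - X s| < e / 2 / (C + 1) by near: s.
have sh : `|h t (X t) - h s (X t)| < e / 2 by near: s.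
have [_ slip] := hlip s (X t) (X s) (le_trans t0 (ltW ts)).
have : C * `|X t - X s| <= e / 2.
  rewrite ltr_pdivlMr ?ltr_wpDl// in sX.
  apply: le_trans (ltW sX); rewrite mulrC ler_wpM2l//; lra.
move=> CX; rewrite (splitr e) (le_lt_trans (ler_distD (h s (X t)) _ _))//.
by rewrite ltr_leD// (le_trans slip).
Unshelve. all: by end_near. Qed.

(* At the common infimum of [P] and [Q], [g <= 0 <= f] by right continuity. *)
Lemma no_downward_alternation {R : realType} (f g : R -> R) (P Q : set R) :
  (forall t, 0 <= t -> f s @[s --> t^'+] --> f t) ->
  (forall t, 0 <= t -> g s @[s --> t^'+] --> g t) ->
  (forall t, 0 <= t -> f t < g t) ->
  (forall p, P p -> 0 <= p /\ g p <= 0) ->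
  (forall q, Q q -> 0 <= f q) ->
  (forall p, P p -> exists2 q, Q q & q <= p) ->
  (forall q, Q q -> exists2 p, P p & p <= q) ->
  P = set0.
Proof.
move=> rcf rcg fg Pg Qf PQ QP; apply: contrapT => /eqP/set0P P0.
have lbP : lbound P 0 by move=> p /Pg[].
pose T := inf P.
have T0 : 0 <= T by exact: lb_le_inf.
have TP p : P p -> T <= p by move=> Pp; apply: ge_inf => //; exists 0.
have TQ q : Q q -> T <= q by move=> /QP[p /TP Tp]; exact: le_trans.
(* The filter at [T^'+] omits [T], where the infimum may be attained; hence the extra premise
   [A T]. *)
have right_nbhs (A : set R) : A T -> (\forall s \near T^'+, A s) ->
    exists2 x, T < x & forall s, T <= s -> s < x -> A s.
  move=> AT [e /= e0 TA]; exists (T + e) => [|s]; first by rewrite ltrDl.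
  rewrite le_eqVlt => /predU1P[<-//|Ts] se; apply: TA => //=.
  by rewrite distrC gtr0_norm ?subr_gt0// ltrBlDl.
have [gT|gT] := ltP 0 (g T).
- have [x Tx gx] : exists2 x, T < x & forall s, T <= s -> s < x -> 0 < g s.
    by apply: right_nbhs => //; exact: cvgr_gt (rcg _ T0) _ gT.
  have [p Pp px] := inf_lt P0 Tx.
  by have := gx p (TP _ Pp) px; rewrite ltNge (Pg p Pp).2.
- have fT : f T < 0 by exact: lt_le_trans (fg _ T0) gT.
  have [x Tx fx] : exists2 x, T < x & forall s, T <= s -> s < x -> f s < 0.
    by apply: right_nbhs => //; exact: cvgr_lt (rcf _ T0) _ fT.
  have [p Pp px] := inf_lt P0 Tx; have [q Qq qp] := PQ _ Pp.
  by have := fx q (TQ _ Qq) (le_lt_trans qp px); rewrite ltNge Qf.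
Qed.

Lemma barrier_pair_lt {R : realType} (l r : R -> R -> R) (t x : R) :
  barrier_pair l r -> 0 <= t -> l t x < r t x.
Proof.
move=> [_ _ _ gap] t0; rewrite -subr_gt0 -lte_fin.
apply: lt_le_trans gap _; apply: ereal_inf_lbound.
by exists (t, x) => //=; split=> //=; rewrite in_itv/= t0.
Qed.

Lemma zero_before_ge0 {R : realType} (F : cumulative R R) (t : R) :
  zero_before F -> 0 <= F t.
Proof.
move=> F0; have [/F0->//|t0] := ltP t 0.
rewrite -(F0 (-1)) ?ltrN10//; apply: (cumulative_is_nondecreasing F); lra.
Qed.

Theorem proposition3p11 (R : realType) (L1 R1 L2 R2 : R -> R -> R)
    (S X1 K1 X2 K2 : R -> R) (Kr1 Kl1 Kr2 Kl2 : cumulative R R)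
    (hLR1 : barrier_pair L1 R1) (hLR2 : barrier_pair L2 R2)
    (hR : forall t x : R, 0 <= t -> R2 t x <= R1 t x)
    (hL : forall t x : R, 0 <= t -> L1 t x <= L2 t x)
    (hS : cadlag S)
    (hsol1 : skorokhod_solution L1 R1 S X1 K1)
    (hdec1 : skorokhod_decomposition L1 R1 X1 K1 Kr1 Kl1)
    (hsol2 : skorokhod_solution L2 R2 S X2 K2)
    (hdec2 : skorokhod_decomposition L2 R2 X2 K2 Kr2 Kl2) :
  forall t : R, 0 <= t -> Kr1 t <= Kr2 t /\ Kl1 t <= Kl2 t.
Proof.
have [cX1 _ X1E _ _] := hsol1; have [_ _ X2E lr2 _] := hsol2.
have [_ [zr1 zl1] K1E nl1 nr1] := hdec1.
have [_ [zr2 zl2] K2E _ _] := hdec2.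
have [bL1 bR1 [c [C [_ _ lipL1 lipR1]]] _] := hLR1.
pose both p := Kr2 p < Kr1 p /\ Kl2 p < Kl1 p.
(* In [P] the path [X1] is on the lower barrier, the zero of [R1]; in [Q] it is on the upper one,
   the zero of [L1]. *)
pose P := [set p | [/\ 0 <= p, R1 p (X1 p) <= 0 & both p]].
pose Q := [set p | [/\ 0 <= p, 0 <= L1 p (X1 p) & both p]].
have lower t : Kr2 t < Kr1 t -> exists2 p, P p & p <= t.
  move=> /(increase_outside_null _ _ _ _ zr1 nr1 (zero_before_ge0 _ t zr2)).
  move=> [p [p0 pt up /negP]]; rewrite -leNgt => Rp; exists p => //.
  have up2 : Kr2 p < Kr1 p.
    by apply: le_lt_trans up; exact: cumulative_is_nondecreasing.
  have X12 : X1 p <= X2 p.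
    rewrite leNgt; apply/negP => /(bR1.2 p p0).
    by apply/negP; rewrite -leNgt (le_trans Rp)// (le_trans (lr2 p p0).2)// hR.
  split=> //; split=> //.
  (* The common [S] cancels, so [X1 p <= X2 p] compares [Kr1 - Kl1] with [Kr2 - Kl2]. *)
  by move: X12; rewrite X1E// X2E// K1E// K2E//; lra.
have upper t : Kl2 t < Kl1 t -> exists2 p, Q p & p <= t.
  move=> /(increase_outside_null _ _ _ _ zl1 nl1 (zero_before_ge0 _ t zl2)).
  move=> [p [p0 pt vp /negP]]; rewrite -leNgt => Lp; exists p => //.
  have vp2 : Kl2 p < Kl1 p.
    by apply: le_lt_trans vp; exact: cumulative_is_nondecreasing.
  (* Mirror image: [L1 p (X2 p) <= L2 p (X2 p) <= 0 <= L1 p (X1 p)]. *)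
  have X21 : X2 p <= X1 p.
    rewrite leNgt; apply/negP => /(bL1.2 p p0).
    by apply/negP; rewrite -leNgt (le_trans _ Lp)// (le_trans _ (lr2 p p0).1)// hL.
  split=> //; split=> //.
  by move: X21; rewrite X1E// X2E// K1E// K2E//; lra.
have P0 : P = set0.
  apply: (@no_downward_alternation _ (fun s => L1 s (X1 s))
    (fun s => R1 s (X1 s)) P Q).
  - exact: right_continuous_barrier_comp bL1 lipL1 cX1.
  - exact: right_continuous_barrier_comp bR1 lipR1 cX1.
  - by move=> t t0; exact: barrier_pair_lt.
  - by move=> p [].
  - by move=> q [].
  - by move=> p [_ _ [_ /upper]].
  - by move=> q [_ _ [/lower]].
(* A violation for [Kr] gives a point of [P] directly, one for [Kl] by way of [Q]. *)
move=> t t0; split; rewrite leNgt; apply/negP.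
- by move=> /lower[p]; rewrite P0.
- by move=> /upper[q [_ _ [/lower[p]]]]; rewrite P0.
Qed.
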